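(* Let $n\ge 3$, let $a_0,\ldots,a_{n-1}$ be indeterminates over $\mathbb{Q}$, $f=x^n+a_{n-1}x^{n-1}+\cdots+a_0$, and let $D_2\in\mathbb{Q}[a_0,\ldots,a_{n-1}]$ be the polynomial obtained by expressing $\prod_{1\le i,j,k\le n,\ i<j,\ j\ne k,\ k\ne i}(2r_k-r_i-r_j)$ ($r_1,\ldots,r_n$ the roots of $f$) in terms of $a_0,\ldots,a_{n-1}$ via Vieta's formulas. Then, with the ideal on the right taken in $\mathbb{Q}[a_0,\ldots,a_{n-1},x,y,w]$ and the ideal on the left in $\mathbb{Q}[a_0,\ldots,a_{n-1}]$, \[\langle D_2\rangle=\left\langle f(x),\,f(y),\,f\left(\tfrac{x+y}{2}\right),\,w(x-y)-1\right\rangle\cap\mathbb{Q}[a_0,\ldots,a_{n-1}].\]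
   Context: $\langle g_1,\ldots,g_m\rangle$ denotes the ideal generated by $g_1,\ldots,g_m$. *)

(* Defs.v *)
From HB Require Import structures.
From mathcomp Require Import all_boot all_order all_algebra.
From mathcomp Require Import mpoly.
Set Implicit Arguments. Unset Strict Implicit. Unset Printing Implicit Defensive.
Import GRing.Theory.
Local Open Scope ring_scope.

Definition in_ideal (T : comNzRingType) (gs : seq T) (p : T) : Prop :=
  exists c : 'I_(size gs) -> T, p = \sum_(i < size gs) c i * gs`_i.

Definition var_a (n : nat) (i : 'I_n) : {mpoly rat[n + 3]} := 'X_(lshift 3 i).
Definition var_x (n : nat) : {mpoly rat[n + 3]} := 'X_(rshift n (0 : 'I_3)).
Definition var_y (n : nat) : {mpoly rat[n + 3]} := 'X_(rshift n (1 : 'I_3)).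
Definition var_w (n : nat) : {mpoly rat[n + 3]} := 'X_(rshift n (2 : 'I_3)).

Definition embed_a (n : nat) (p : {mpoly rat[n]}) : {mpoly rat[n + 3]} :=
  mmap (fun c : rat => c%:MP) (@var_a n) p.

Definition fgen (n : nat) (t : {mpoly rat[n + 3]}) : {mpoly rat[n + 3]} :=
  t ^+ n + \sum_(i < n) var_a i * t ^+ i.

(* Product over 1<=i,j,k<=n, i<j, j<>k, k<>i of (2 r_k - r_i - r_j),
   in Q[r_1,...,r_n] (roots r as variables 'X_k, 0-indexed). *)
Definition D2_roots (n : nat) : {mpoly rat[n]} :=
  \prod_(i < n) \prod_(j < n | (i < j)%N) \prod_(k < n | (j != k) && (k != i))
     (2%:R * 'X_k - 'X_i - 'X_j).

(* Vieta: f = prod_k (t - r_k), so a_i = (-1)^(n-i) e_(n-i)(r). *)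
Definition vieta_coef (n : nat) (i : 'I_n) : {mpoly rat[n]} :=
  (-1) ^+ (n - i) * mesym n rat (n - i).

Definition is_D2 (n : nat) (D : {mpoly rat[n]}) : Prop :=
  mmap (fun c : rat => c%:MP) (@vieta_coef n) D = D2_roots n.

(* Main.v *)
Require Import Defs.
From HB Require Import structures.
From mathcomp Require Import all_boot all_order all_algebra.
From mathcomp Require Import fingroup perm mpoly ring.
Set Implicit Arguments. Unset Strict Implicit. Unset Printing Implicit Defensive.
Import GRing.Theory.
Local Open Scope ring_scope.

(* The Vieta map a_i |-> (-1)^(n-i) e_(n-i)(r) identifies Q[a] with the symmetric
   polynomials in the roots r.

   If p lies in the elimination ideal, then for every factor 2 r_k - r_i - r_j
   one may specialize x to r_i, y to r_j, w to 1/(r_i - r_j) and r_k to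
   (r_i + r_j)/2: all generators vanish, so p(r) vanishes on the hyperplane
   2 r_k = r_i + r_j.  These hyperplanes are pairwise distinct, hence D_2(r)
   divides p(r), and the quotient is again symmetric.

   Conversely, since x - y is invertible modulo the ideal, Newton interpolation at
   x, y, z = (x+y)/2 gives f = (t-x)(t-y)(t-z) g modulo the ideal.  The value of
   D_2 at the coefficients of (t-x)(t-y)(t-z) g is 0: for a generic monic g this
   can be tested after replacing the coefficients of g by elementary symmetric
   polynomials, where the factor 2z - x - y of D_2 appears. *)

(** * Membership in a finitely generated ideal *)

Section Ideals.
Variable T : comNzRingType.
Implicit Types (gs : seq T) (p q c : T).

Lemma in_ideal0 gs : in_ideal gs 0.
Proof. by exists (fun=> 0); rewrite big1 // => i _; rewrite mul0r. Qed.

Lemma in_idealD gs p q : in_ideal gs p -> in_ideal gs q -> in_ideal gs (p + q).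
Proof.
move=> [c ->] [d ->]; exists (fun i => c i + d i).
by rewrite -big_split; apply: eq_bigr => i _; rewrite mulrDl.
Qed.

Lemma in_idealMl gs c p : in_ideal gs p -> in_ideal gs (c * p).
Proof.
move=> [d ->]; exists (fun i => c * d i).
by rewrite mulr_sumr; apply: eq_bigr => i _; rewrite mulrA.
Qed.

Lemma in_idealMr gs c p : in_ideal gs p -> in_ideal gs (p * c).
Proof. by rewrite mulrC; apply: in_idealMl. Qed.

Lemma in_idealB gs p q : in_ideal gs p -> in_ideal gs q -> in_ideal gs (p - q).
Proof.
by move=> hp hq; rewrite -mulN1r; apply: in_idealD => //; apply: in_idealMl.
Qed.

Lemma in_ideal_sum gs (I : Type) (r : seq I) (P : pred I) (F : I -> T) :
  (forall i, P i -> in_ideal gs (F i)) -> in_ideal gs (\sum_(i <- r | P i) F i).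
Proof.
by move=> hF; apply: big_ind => //; [exact: in_ideal0 | exact: in_idealD].
Qed.

Lemma in_ideal_nth gs (i : 'I_(size gs)) : in_ideal gs gs`_i.
Proof.
exists (fun j => (j == i)%:R); rewrite (bigD1 i) //= eqxx mul1r big1 ?addr0 //.
by move=> j /negbTE ->; rewrite mul0r.
Qed.

Lemma in_ideal_mem gs p : p \in gs -> in_ideal gs p.
Proof. by case/(nthP 0) => i hi <-; apply: (in_ideal_nth (Ordinal hi)). Qed.

Lemma in_ideal1P g p : in_ideal [:: g] p <-> exists c, p = c * g.
Proof.
split=> [[c ->]|[c ->]]; first by exists (c ord0); rewrite big_ord1.
by apply/in_idealMl/in_ideal_mem; rewrite mem_head.
Qed.

Lemma in_ideal_subM gs a b c d :
  in_ideal gs (a - b) -> in_ideal gs (c - d) -> in_ideal gs (a * c - b * d).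
Proof.
move=> hab hcd; have -> : a * c - b * d = (a - b) * c + b * (c - d) by ring.
by apply: in_idealD; [apply: in_idealMr | apply: in_idealMl].
Qed.

(** Congruence modulo an ideal respects products, hence powers, monomials and polynomials. *)
Lemma in_ideal_sub_mmap gs (R : nzRingType) n (f : R -> T) (h h' : 'I_n -> T)
    (p : {mpoly R[n]}) :
  (forall i, in_ideal gs (h i - h' i)) ->
  in_ideal gs (mmap f h p - mmap f h' p).
Proof.
move=> hh; rewrite -sumrB; apply: in_ideal_sum => m _; rewrite -mulrBr.
apply: in_idealMl; apply: (big_ind2 (fun a b => in_ideal gs (a - b))).
- by rewrite subrr; apply: in_ideal0.
- by move=> a b c d; apply: in_ideal_subM.
move=> i _; elim: (m i) => [|e IH]; first by rewrite subrr; apply: in_ideal0.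
by rewrite !exprS; apply: in_ideal_subM.
Qed.

End Ideals.

(** * Evaluation of multivariate polynomials under ring morphisms *)

Lemma rmorph_mmap (R : nzRingType) (S S' : nzRingType) n (g : {rmorphism S -> S'})
    (f : R -> S) (h : 'I_n -> S) (p : {mpoly R[n]}) :
  g (mmap f h p) = mmap (g \o f) (g \o h) p.
Proof.
rewrite rmorph_sum; apply: eq_bigr => m _; rewrite rmorphM rmorph_prod.
by congr (_ * _); apply: eq_bigr => i _; rewrite rmorphXn.
Qed.

Lemma eq_mmap (R S : nzRingType) n (f f' : R -> S) (h h' : 'I_n -> S)
    (p : {mpoly R[n]}) : f =1 f' -> h =1 h' -> mmap f h p = mmap f' h' p.
Proof.
by move=> ef eh; apply: eq_bigr => m _; rewrite ef (mmap1_eq _ eh).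
Qed.

Lemma mmap_id (R : nzRingType) n (p : {mpoly R[n]}) :
  mmap (@mpolyC n R) (fun i => 'X_i) p = p.
Proof.
rewrite {2}[p]mpolyE; apply: eq_bigr => m _.
by rewrite mmap1_id mul_mpolyC.
Qed.

(** * The Vieta substitution and symmetric polynomials *)

Section Vieta.
Variables (n : nat) (R : idomainType).

Definition vieta (i : 'I_n) : {mpoly R[n]} :=
  (-1) ^+ (n - i) * mesym n R (n - i).

Lemma vieta_sym i : vieta i \is symmetric.
Proof. by rewrite rpredM ?mesym_sym // rpredX // rpredN rpred1. Qed.

Lemma prod_XsubC_vieta :
  \prod_(i < n) ('X - ('X_i)%:P) =
  'X^n + \sum_(i < n) vieta i *: 'X^i :> {poly {mpoly R[n]}}.
Proof.
pose cs : n.-tuple {mpoly R[n]} := [tuple 'X_i | i < n].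
have eP : \prod_(i < n) ('X - ('X_i)%:P) = \prod_(c <- cs) ('X - c%:P)
    :> {poly {mpoly R[n]}}.
  by rewrite big_tuple; apply: eq_bigr => i _; rewrite tnth_mktuple.
have szP : size (\prod_(c <- cs) ('X - c%:P)) = n.+1.
  by rewrite size_prod_XsubC size_tuple.
rewrite eP -[LHS]coefK szP poly_def big_ord_recr /= addrC; congr (_ + _).
  have : \prod_(c <- cs) ('X - c%:P) \is monic by apply: monic_prod_XsubC.
  by rewrite monicE lead_coefE szP /= => /eqP ->; rewrite scale1r.
apply: eq_bigr => i _; congr (_ *: _).
have lt : (n - i < n.+1)%N by rewrite ltnS leq_subr.
have := mroots_coeff cs (Ordinal lt) => /=.
rewrite subKn 1?ltnW // => ->; congr (_ * _).
rewrite /mesym rmorph_sum; apply: eq_bigr => h _.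
rewrite rmorph_prod; apply: eq_bigr => j _.
by rewrite /= mevalXU tnth_mktuple.
Qed.

Lemma coef_monic_form (S : nzRingType) (a : 'I_n -> S) (i : 'I_n) :
  ('X^n + \sum_(j < n) a j *: 'X^j)`_i = a i.
Proof.
rewrite coefD coefXn ltn_eqF // add0r coef_sum (bigD1 i) //= big1 ?addr0.
  by rewrite coefZ coefXn eqxx mulr1.
by move=> j /negbTE ne; rewrite coefZ coefXn eq_sym -[_ == _]/(j == i) ne mulr0.
Qed.

(** Mutually inverse changes of variables between the order a_0, ..., a_(n-1) of coefficients and
    the order e_1, ..., e_n of elementary symmetric polynomials, with the Vieta signs. *)
Let sgnrev (i : 'I_n) : {mpoly R[n]} := (-1) ^+ (n - i) * 'X_(rev_ord i).
Let sgnrev' (i : 'I_n) : {mpoly R[n]} := (-1) ^+ i.+1 * 'X_(rev_ord i).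
Let S := [tuple mesym n R i.+1 | i < n].

(** The Vieta map is the invertible substitution [sgnrev] followed by evaluation at e_1, ..., e_n,
    which are algebraically independent. *)
Lemma mmap_vieta_inj (p : {mpoly R[n]}) :
  mmap (@mpolyC n R) vieta p = 0 -> p = 0.
Proof.
have -> : mmap (@mpolyC n R) vieta p = mmap (@mpolyC n R) sgnrev p \mPo S.
  rewrite rmorph_mmap; apply: eq_mmap => [c|i] /=; first by rewrite comp_mpolyC.
  rewrite rmorphM rmorphXn rmorphN1 /= comp_mpolyXU -tnth_nth tnth_mktuple /=.
  by rewrite subnSK.
move/msym_fundamental_un0 => h0; rewrite -[p]mmap_id.
have := congr1 (mmap (@mpolyC n R) sgnrev') h0.
rewrite rmorph_mmap rmorph0 => <-; apply: eq_mmap => [c|i] /=.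
  by rewrite mmapC.
rewrite rmorphM rmorphXn rmorphN1 /= mmapX mmap1U /sgnrev' /= rev_ordK.
by rewrite subnSK // mulrA -exprD addnn -mul2n exprM sqrrN !expr1n mul1r.
Qed.

Lemma mmap_vieta_surj (p : {mpoly R[n]}) :
  p \is symmetric -> exists q, mmap (@mpolyC n R) vieta q = p.
Proof.
move=> /sym_fundamental[t [<- _]]; exists (mmap (@mpolyC n R) sgnrev' t).
rewrite rmorph_mmap; apply: eq_mmap => [c|i] /=; first by rewrite mmapC.
rewrite rmorphM rmorphXn rmorphN1 /= mmapX mmap1U /vieta /=.
by rewrite subKn // mulrA -exprD addnn -mul2n exprM sqrrN !expr1n mul1r tnth_mktuple.
Qed.

Lemma mmap_vieta_sym (p : {mpoly R[n]}) :
  mmap (@mpolyC n R) vieta p \is symmetric.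
Proof.
apply/issymP => s; rewrite rmorph_mmap; apply: eq_mmap => [c|i] /=.
  by rewrite /msym mmapC.
by move/issymP: (vieta_sym i).
Qed.

(** The generic factorization is mapped through evaluation of the roots at [r]. *)
Lemma mmap_vieta_coef (T : comNzRingType) (f : {rmorphism R -> T})
    (r : 'I_n -> T) (i : 'I_n) :
  mmap f r (vieta i) = (\prod_(j < n) ('X - (r j)%:P))`_i.
Proof.
have := congr1 (map_poly (mmap f r)) prod_XsubC_vieta.
rewrite rmorph_prod /= => eP.
have -> : \prod_(j < n) ('X - (r j)%:P) =
          map_poly (mmap f r) ('X^n + \sum_(i < n) vieta i *: 'X^i).
  rewrite -eP; apply: eq_bigr => j _.
  by rewrite rmorphB /= map_polyX map_polyC /= mmapX mmap1U.
by rewrite coef_map coef_monic_form.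
Qed.

End Vieta.

(** * The hyperplanes 2 r_k = r_i + r_j and their product D_2 *)

Section Midpoints.
Variable n : nat.
Notation M := {mpoly rat[n]}.
Notation triple := ('I_n * 'I_n * 'I_n)%type.
Implicit Types t u : triple.

Definition midtriple : pred triple :=
  fun t => [&& (t.1.1 < t.1.2)%N, t.1.2 != t.2 & t.2 != t.1.1].

Definition midform (T : pzRingType) (r : 'I_n -> T) t : T :=
  2%:R * r t.2 - r t.1.1 - r t.1.2.

Lemma D2_rootsE :
  D2_roots n = \prod_(t | midtriple t) midform (fun i => 'X_i) t.
Proof.
rewrite /D2_roots pair_big_dep /= pair_big_dep /=.
by apply: eq_bigl => -[[i j] k] /=; rewrite /midtriple /= -?andbA.
Qed.

Lemma rmorph_midform (S T : pzRingType) (g : {rmorphism S -> T}) r t :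
  g (midform r t) = midform (g \o r) t.
Proof. by rewrite /midform !rmorphB rmorphM rmorph_nat. Qed.

(* The action of s on triples (unordered pair {i, j}, k), with i < j. *)
Let sortedact (s : 'S_n) t : triple :=
  if (s t.1.1 < s t.1.2)%N then (s t.1.1, s t.1.2, s t.2)
  else (s t.1.2, s t.1.1, s t.2).

(** A permutation of the roots permutes the factors: each is symmetric in i and j, so these can be
    put back in increasing order. *)
Lemma D2_roots_sym : D2_roots n \is symmetric.
Proof.
apply/issymP => s; rewrite D2_rootsE rmorph_prod /=.
have actK s' t : midtriple t -> sortedact s' (sortedact s'^-1%g t) = t.
  case: t => [[i j] k] /and3P[/= ij _ _]; rewrite /sortedact /=.
  case: (ltnP (s'^-1%g i)) => /= _; rewrite !permKV ?ij //.
  by rewrite ltnNge ltnW.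
have act_mid s' t : midtriple t -> midtriple (sortedact s' t).
  case: t => [[i j] k] /and3P[/= ij jk ki]; rewrite /sortedact /=.
  case: ifP => /= h; rewrite /midtriple /= !(inj_eq perm_inj) ?jk ?ki ?h //=.
  rewrite eq_sym ki eq_sym jk !andbT ltn_neqAle leqNgt h andbT.
  by rewrite val_eqE (inj_eq perm_inj) -val_eqE gtn_eqF.
rewrite [RHS](reindex_onto (sortedact s) (sortedact s^-1%g)); last first.
  by move=> t; apply: actK.
apply: eq_big => [t|t ht].
  apply/idP/andP => [ht|[ht /eqP <-]]; last exact: act_mid.
  split; first exact: act_mid.
  by apply/eqP; have := actK s^-1%g t ht; rewrite invgK.
rewrite rmorph_midform /midform /sortedact /=.
have E i : msym s 'X_i = 'X_(s i) :> M by rewrite /msym mmapX mmap1U.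
by case: ifP => _ /=; rewrite !E // addrAC.
Qed.

Lemma midform_separates t u : midtriple t -> midtriple u -> t != u ->
  exists2 v : 'I_n -> rat, midform v t = 0 & midform v u != 0.
Proof.
case: t u => [[i j] k] [[i' j'] k'] /and3P[/= ij jk ki] /and3P[/= ij' jk' ki'].
have ne : (i == j) = false by rewrite -val_eqE ltn_eqF.
have ne' : (i' == j') = false by rewrite -val_eqE ltn_eqF.
rewrite !xpair_eqE => netu; rewrite /midform /=.
(* The indicator of an index [l] of [u] outside [t] kills the form of [t] and gives 2 or -1 on that
   of [u]. *)
have delta l : l \notin [:: i; j; k] -> l \in [:: i'; j'; k'] ->
  exists2 v : 'I_n -> rat, 2%:R * v k - v i - v j = 0 &
                           2%:R * v k' - v i' - v j' != 0.
  rewrite !inE !negb_or => /and3P[li lj lk] hl.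
  exists (fun a => (a == l)%:R).
    by rewrite ![_ == l]eq_sym (negbTE li) (negbTE lj) (negbTE lk).
  case/or3P: hl => /eqP ->; rewrite ?eqxx.
  - by rewrite ![_ == i']eq_sym ne' [i' == k']eq_sym (negbTE ki').
  - by rewrite ne' [k' == j']eq_sym (negbTE jk').
  - by rewrite [i' == k']eq_sym (negbTE ki') (negbTE jk').
have [kk|/negbTE kk] := eqVneq k' k.
  subst k'; case hi : (i' \in [:: i; j; k]); last first.
    by apply: (delta i'); rewrite ?hi // inE eqxx.
  case hj : (j' \in [:: i; j; k]); last first.
    by apply: (delta j'); rewrite ?hj // !inE eqxx orbT.
  (* Here i' and j' both differ from k, so {i', j'} = {i, j}, and the ordering forces [t = u]. *)
  exfalso; move: hi hj netu; rewrite !inE [i' == k]eq_sym (negbTE ki') (negbTE jk') !orbF.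
  by case/orP=> /eqP e1; case/orP => /eqP e2; subst i' j';
     rewrite ?eqxx ?ltnn // in ij' *; move: (ltn_trans ij ij'); rewrite ltnn.
case hk : (k' \in [:: i; j]); last first.
  by apply: (delta k'); rewrite !inE ?eqxx ?orbT // kk orbF; move: hk; rewrite !inE => ->.
(* The value 0 at k is the midpoint of 1 and -1. As k' is i or j, its value is 1 or -1, while those
   at i' and j' are 0 or of opposite sign, so nothing cancels. *)
exists (fun a => (a == i)%:R - (a == j)%:R).
  by rewrite !eqxx (negbTE ki) [k == j]eq_sym (negbTE jk) ne [j == i]eq_sym ne.
move: hk; rewrite !inE => /orP[] /eqP hk; subst k'; rewrite !eqxx ?[j == i]eq_sym ne.
  rewrite (negbTE jk') [i' == i]eq_sym (negbTE ki').
  by case: (i' == j); case: (j' == j).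
rewrite (negbTE jk') [i' == j]eq_sym (negbTE ki').
by case: (i' == i); case: (j' == i).
Qed.

(** Applying this substitution restricts a polynomial to the hyperplane of [t]. *)
Definition midsubst t (l : 'I_n) : M :=
  if l == t.2 then (2%:R^-1)%:MP * ('X_t.1.1 + 'X_t.1.2) else 'X_l.

Notation subst t := (mmap (@mpolyC n rat) (midsubst t)).

Lemma meval_subst t (v : 'I_n -> rat) (p : M) : midform v t = 0 ->
  meval v (subst t p) = meval v p.
Proof.
rewrite /midform => hv; rewrite rmorph_mmap; apply: eq_mmap => [c|l] /=.
  by rewrite mevalC.
rewrite /midsubst; case: eqP => [->|_]; last by rewrite mevalXU.
rewrite mevalM mevalC mevalD !mevalXU; apply: (@mulfI _ 2%:R) => //.
by rewrite mulrA mulfV // mul1r; apply/eqP; rewrite eq_sym -subr_eq0 opprD addrA hv.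
Qed.

(** Evaluation at a separating point on the hyperplane of [t], where restriction does not change
    values. *)
Lemma subst_midform_neq0 t u : midtriple t -> midtriple u -> t != u ->
  subst t (midform (fun i => 'X_i) u) != 0.
Proof.
move=> ht hu /(midform_separates ht hu)[v hvt hvu].
apply: contraNneq hvu => /(congr1 (meval v)).
rewrite meval_subst // rmorph_midform rmorph0 => h.
by rewrite -h; apply/eqP; rewrite /midform /= !mevalXU.
Qed.

(** The variable r_k and its replacement differ by half the linear form, so [p] is congruent to its
    restriction modulo that form. *)
Lemma midform_dvd t (p : M) : subst t p = 0 ->
  exists q, p = midform (fun i => 'X_i) t * q.
Proof.
move=> h0; have : in_ideal [:: midform (fun i => 'X_i : M) t] (p - subst t p).
  rewrite -{1}[p]mmap_id; apply: in_ideal_sub_mmap => l; rewrite /midsubst.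
  case: eqP => [->|_]; last by rewrite subrr; apply: in_ideal0.
  apply/in_ideal1P; exists (2%:R^-1)%:MP; rewrite /midform.
  have e2 : (2%:R^-1)%:MP * 2%:R = 1 :> M.
    by rewrite -mpolyC_nat -mpolyCM mulVf.
  by rewrite !mulrBr mulrDr mulrA e2 mul1r opprD addrA.
by rewrite h0 subr0 => /in_ideal1P[q ->]; exists q; rewrite mulrC.
Qed.

(** The forms are divided out one at a time: a removed form is nonzero on each remaining hyperplane,
    so the quotient still vanishes there. *)
Lemma D2_roots_dvd (p : M) : (forall t, midtriple t -> subst t p = 0) ->
  exists q, p = D2_roots n * q.
Proof.
rewrite D2_rootsE -big_filter.
have : all midtriple [seq t <- index_enum triple | midtriple t] by apply: filter_all.
have : uniq [seq t <- index_enum triple | midtriple t].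
  by rewrite filter_uniq ?index_enum_uniq.
move=> us hs h.
have {h} : forall t, t \in [seq t <- index_enum triple | midtriple t] -> subst t p = 0.
  by move=> t; rewrite mem_filter => /andP[ht _]; apply: h.
elim: [seq t <- _ | _] us hs p => [|t r IH] /=.
  by move=> _ _ p _; exists p; rewrite big_nil mul1r.
move=> /andP[tr ur] /andP[ht hr] p h.
have [|q ep] := @midform_dvd t p; first by apply: h; rewrite mem_head.
have [|q' eq] := IH ur hr q.
  move=> u hu; have /eqP : subst u p = 0 by apply: h; rewrite inE hu orbT.
  rewrite ep rmorphM mulf_eq0 => /orP[|/eqP //]; apply: contraTeq => _.
  apply: subst_midform_neq0 => //; first exact: (allP hr).
  by apply: contraNneq tr => <-.
by exists q'; rewrite big_cons ep eq mulrA.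
Qed.

Lemma D2_roots_neq0 : D2_roots n != 0.
Proof.
rewrite D2_rootsE; apply/prodf_neq0 => -[[i j] k] /and3P[/= _ jk ki].
apply/eqP => /(congr1 (meval (fun l => (l == k)%:R))).
rewrite rmorph_midform rmorph0 /midform /= !mevalXU eqxx.
by rewrite (negbTE jk) [i == k]eq_sym (negbTE ki).
Qed.

End Midpoints.

(** * Specialization of the variables a, x, y, w *)

Section Specialization.
Variables (n : nat) (T : comNzRingType) (f : {rmorphism rat -> T}).
Variables (a : 'I_n -> T) (x y w : T).

Definition spec_point (i : 'I_(n + 3)) : T :=
  match split i with inl j => a j | inr k => [:: x; y; w]`_k end.

Notation spec := (mmap f spec_point).

Lemma spec_var_a i : spec (var_a i) = a i.
Proof. by rewrite /var_a mmapX mmap1U /spec_point (unsplitK (inl i)). Qed.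

Lemma spec_var_x : spec (var_x n) = x.
Proof. by rewrite /var_x mmapX mmap1U /spec_point (unsplitK (inr _)). Qed.

Lemma spec_var_y : spec (var_y n) = y.
Proof. by rewrite /var_y mmapX mmap1U /spec_point (unsplitK (inr _)). Qed.

Lemma spec_var_w : spec (var_w n) = w.
Proof. by rewrite /var_w mmapX mmap1U /spec_point (unsplitK (inr _)). Qed.

Lemma spec_embed_a p : spec (embed_a p) = mmap f a p.
Proof.
rewrite rmorph_mmap; apply: eq_mmap => [c|i] /=; first by rewrite mmapC.
exact: spec_var_a.
Qed.

Lemma spec_fgen t : spec (fgen t) = ('X^n + \sum_(i < n) a i *: 'X^i).[spec t].
Proof.
rewrite rmorphD rmorphXn rmorph_sum hornerD hornerXn horner_sum; congr (_ + _).
by apply: eq_bigr => i _; rewrite rmorphM rmorphXn /= spec_var_a hornerZ hornerXn.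
Qed.

End Specialization.

(** * Monic univariate polynomials and division by a linear factor *)

Lemma monic_formE (R : nzRingType) n (p : {poly R}) :
  p \is monic -> size p = n.+1 -> p = 'X^n + \sum_(i < n) p`_i *: 'X^i.
Proof.
move=> mp sp; rewrite -[LHS]coefK sp poly_def big_ord_recr /= addrC.
by move: mp; rewrite monicE lead_coefE sp /= => /eqP ->; rewrite scale1r.
Qed.

Lemma size_monic_form (R : nzRingType) n (a : 'I_n -> R) :
  size ('X^n + \sum_(i < n) a i *: 'X^i : {poly R})%R = n.+1 /\
  'X^n + \sum_(i < n) a i *: 'X^i \is monic.
Proof.
have lt : (size (\sum_(i < n) a i *: 'X^i : {poly R})%R < size ('X^n : {poly R}))%N.
  rewrite size_polyXn ltnS; apply: (leq_trans (size_sum _ _ _)).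
  apply/bigmax_leqP => i _; apply: (leq_trans (size_scale_leq _ _)).
  by rewrite size_polyXn.
by rewrite size_polyDl // size_polyXn monicE lead_coefDl // lead_coefXn.
Qed.

Lemma monic_div_XsubC (R : comNzRingType) m (p : {poly R}) (c : R) :
  p \is monic -> size p = m.+2 ->
  exists q, [/\ q \is monic, size q = m.+1 & p = q * ('X - c%:P) + p.[c]%:P].
Proof.
move=> mp sp; have : root (p - p.[c]%:P) c by rewrite rootE !hornerE subrr.
case/factor_theorem => q eq; exists q.
have lt : (size (- p.[c]%:P) < size p)%N.
  by rewrite size_polyN sp (leq_ltn_trans (size_polyC_leq1 _)).
have mq : q \is monic.
  rewrite monicE -(lead_coef_Mmonic _ (monicXsubC c)) -eq lead_coefDl //.
split=> //; last by rewrite -eq subrK.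
have := congr1 (size : {poly R} -> nat) eq.
rewrite size_polyDl // sp size_Mmonic ?monicXsubC ?monic_neq0 //.
by rewrite size_XsubC addn2 /= => -[].
Qed.

(** * Vanishing of D_2 when one root is the midpoint of two others *)

Section Midpoint.
Variables (k : nat) (T : idomainType) (f : {rmorphism rat -> T}).
Variables (x y z : T) (D : {mpoly rat[k.+3]}).
Hypotheses (hz : 2%:R * z = x + y) (hD : is_D2 D).

Lemma mmap_D2_roots (S : comNzRingType) (g : {rmorphism rat -> S}) (r : 'I_k.+3 -> S) :
  mmap g (fun i : 'I_k.+3 => (\prod_(j < k.+3) ('X - (r j)%:P))`_i) D =
  mmap g r (D2_roots k.+3).
Proof.
rewrite -hD rmorph_mmap; apply: eq_mmap => [c|i] /=; first by rewrite mmapC.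
by rewrite -(mmap_vieta_coef g).
Qed.

Lemma D2_midpoint_root (g : {poly T}) : g \is monic -> size g = k.+1 ->
  mmap f (fun i : 'I_k.+3 =>
    (('X - x%:P) * (('X - y%:P) * (('X - z%:P) * g)))`_i) D = 0.
Proof.
move=> mg sg.
pose U := {mpoly T[k]}.
pose C : T -> U := @mpolyC k T.
pose P (S : nzRingType) (h : T -> S) (q : {poly S}) : {poly S} :=
  ('X - (h x)%:P) * (('X - (h y)%:P) * (('X - (h z)%:P) * q)).
have mapP (S S' : nzRingType) (h : T -> S) (e : {rmorphism S -> S'}) q :
    map_poly e (P S h q) = P S' (e \o h) (map_poly e q).
  by rewrite /P !rmorphM !rmorphB /= !map_polyX !map_polyC.
(* The coefficients of [g] are made indeterminate, so that [gen] splits after the injective Vieta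
   substitution. *)
pose gen : {poly U} := 'X^k + \sum_(i < k) 'X_i *: 'X^i.
pose E : U := mmap (C \o f) (fun i : 'I_k.+3 => (P U C gen)`_i) D.
have gen_vieta : map_poly (mmap C (@vieta k T)) gen =
    \prod_(i < k) ('X - ('X_i)%:P) :> {poly U}.
  rewrite prod_XsubC_vieta rmorphD rmorph_sum /= map_polyXn; congr (_ + _).
  by apply: eq_bigr => j _; rewrite map_polyZ map_polyXn /= mmapX mmap1U.
have gen_eval : map_poly (meval (fun i : 'I_k => g`_i)) gen = g.
  rewrite [RHS](monic_formE mg sg) rmorphD rmorph_sum /= map_polyXn.
  by congr (_ + _); apply: eq_bigr => j _; rewrite map_polyZ map_polyXn /= mevalXU.
have E0 : E = 0.
  apply: mmap_vieta_inj; rewrite /E rmorph_mmap.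
  pose r := tnth [tuple of [:: C x, C y, C z & [tuple 'X_i | i < k] : seq U]].
  transitivity (mmap (C \o f) r (D2_roots k.+3)); last first.
    rewrite D2_rootsE rmorph_prod.
    (* The roots at positions 0, 1, 2 are x, y, z; the factor of this triple is 2z - x - y, which is
       0 by [hz]. *)
    rewrite (bigD1 (inord 0, inord 1, inord 2)) /=; last first.
      by rewrite /midtriple /= -!val_eqE /= !inordK.
    rewrite rmorph_midform /midform /= !mmapX !mmap1U /r !(tnth_nth 0) /= !inordK //=.
    rewrite -[2%:R](rmorph_nat C) -rmorphM hz rmorphD.
    by rewrite addrAC addrK subrr mul0r.
  rewrite -mmap_D2_roots; apply: eq_mmap => [c|i] /=; first by rewrite mmapC.
  rewrite -coef_map mapP; congr (_`_ _).
  rewrite /r -(big_tuple _ _ _ xpredT (fun c => 'X - c%:P)) !big_cons.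
  by rewrite /P /= !mmapC gen_vieta big_map big_enum.
(* The indeterminates are specialized to the actual coefficients of [g]. *)
have := congr1 (meval (fun i : 'I_k => g`_i)) E0.
rewrite /E rmorph0 rmorph_mmap => ev0; rewrite -[RHS]ev0; apply: eq_mmap => [c|i] /=.
  by rewrite mevalC.
by rewrite -coef_map mapP /P /= !mevalC gen_eval.
Qed.

End Midpoint.

(** * The two inclusions *)

Definition midpoint_gens (n : nat) : seq {mpoly rat[n + 3]} :=
  [:: fgen (var_x n); fgen (var_y n);
      fgen (((2%:R : rat)^-1)%:MP * (var_x n + var_y n));
      var_w n * (var_x n - var_y n) - 1].

Lemma newton_in_ideal (T : comNzRingType) (gs : seq T) m (p : {poly T}) (x y z w : T) :
  p \is monic -> size p = m.+4 -> 2%:R * z = x + y ->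
  in_ideal gs p.[x] -> in_ideal gs p.[y] -> in_ideal gs p.[z] ->
  in_ideal gs (w * (x - y) - 1) ->
  exists g, [/\ g \is monic, size g = m.+1 &
    forall i, in_ideal gs
      (p`_i - (('X - x%:P) * (('X - y%:P) * (('X - z%:P) * g)))`_i)].
Proof.
move=> mp sp hz px py pz hw.
(* Modulo the ideal, [w] is an inverse of [x - y]. *)
have cancel c : in_ideal gs (c * (x - y)) -> in_ideal gs c.
  move=> hc; have -> : c = w * (c * (x - y)) - c * (w * (x - y) - 1) by ring.
  by apply: in_idealB; apply: in_idealMl.
have [q1 [mq1 sq1 e1]] := monic_div_XsubC x mp sp.
have [q2 [mq2 sq2 e2]] := monic_div_XsubC y mq1 sq1.
have [g [mg sg e3]] := monic_div_XsubC z mq2 sq2.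
(* The remainders [q1.[y]] and [q2.[z]] are the divided differences of [p] at x, y and at x, y,
   z. *)
have q1y : in_ideal gs q1.[y].
  apply: cancel.
  have -> : q1.[y] * (x - y) = p.[x] - p.[y].
    by rewrite {2}e1 !hornerE; ring.
  exact: in_idealB.
have q2z : in_ideal gs q2.[z].
  apply: (cancel); apply: (cancel).
  (* The 4 and the sign come from 4(z - x)(z - y) = -(x - y)^2. *)
  have -> : q2.[z] * (x - y) * (x - y) =
    4%:R * (q1.[y] * (z - x) + p.[x] - p.[z]).
    have -> : p.[z] = (q2.[z] * (z - y) + q1.[y]) * (z - x) + p.[x].
      by rewrite {1}e1 {1}e2 !hornerE.
    have -> : x = 2%:R * z - y by rewrite hz; ring.
    by ring.
  apply/in_idealMl/in_idealB => //; apply: in_idealD => //; exact: in_idealMr.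
exists g; split=> // i; set F := _ * _.
(* Coefficient of index i in the Newton form of [p]. *)
have -> : p`_i - F`_i =
    q2.[z] * (('X - x%:P) * ('X - y%:P))`_i + q1.[y] * ('X - x%:P)`_i
    + p.[x] * (1 : {poly T})`_i.
  rewrite -!coefZ -!coefD -coefB; congr (nth 0 (polyseq _) i).
  rewrite -!mul_polyC /F {1}e1 {1}e2 {1}e3; ring.
by do 2?apply: in_idealD; apply: in_idealMr.
Qed.

Lemma embed_D2_in_ideal n (D : {mpoly rat[n]}) : (3 <= n)%N -> is_D2 D ->
  in_ideal (midpoint_gens n) (embed_a D).
Proof.
case: n D => [|[|[|k]]] // D _ hD; set n := k.+3 in D hD *.
set gs := midpoint_gens n.
pose F : {poly {mpoly rat[n + 3]}} := 'X^n + \sum_(i < n) var_a i *: 'X^i.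
have [sF mF] := size_monic_form (@var_a n).
have Ft t : F.[t] = fgen t.
  rewrite hornerD hornerXn horner_sum; congr (_ + _).
  by apply: eq_bigr => i _; rewrite hornerZ hornerXn.
set z := ((2%:R : rat)^-1)%:MP * (var_x n + var_y n).
have hz : 2%:R * z = var_x n + var_y n.
  by rewrite /z mulrA -mpolyC_nat -mpolyCM mulfV // mpolyC1 mul1r.
have mem := fun p => @in_ideal_mem _ gs p.
have [||||g [mg sg hg]] := @newton_in_ideal _ gs k F _ _ z (var_w n) mF sF hz.
- by apply: mem; rewrite Ft !inE eqxx.
- by apply: mem; rewrite Ft !inE eqxx ?orbT.
- by apply: mem; rewrite Ft !inE eqxx ?orbT.
- by apply: mem; rewrite !inE eqxx ?orbT.
(* The subtracted 0 is the value of [D] at the coefficients of the product with a midpoint root,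
   which are congruent to the variables a_i. *)
rewrite -[embed_a D]subr0 -(D2_midpoint_root (@mpolyC _ rat) hz hD mg sg).
apply: in_ideal_sub_mmap => i.
by have := hg i; rewrite coef_monic_form.
Qed.

(** The coefficients a are sent to those of the polynomial whose roots are restricted to the
    hyperplane of [t]; all generators then vanish. *)
Lemma subst_vieta_eq0 n (p : {mpoly rat[n]}) t : midtriple t ->
  in_ideal (midpoint_gens n) (embed_a p) ->
  mmap (@mpolyC n rat) (midsubst t) (mmap (@mpolyC n rat) (@vieta_coef n) p) = 0.
Proof.
case: t => [[i j] k] /and3P[/= ij jk ki] [c ec].
set t := (i, j, k).
pose M := {mpoly rat[n]}.
pose r : 'I_n -> M := midsubst t.
pose a l : M := mmap (@mpolyC n rat) r (vieta_coef l).
(* The fraction field supplies the value 1/(r_i - r_j) for w; since [fr] is injective, the final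
   vanishing descends to polynomials. *)
pose fr : M -> {fraction M} := @tofrac M.
have ne : 'X_i - 'X_j != 0 :> M.
  apply/eqP => /(congr1 (meval (fun l => (l == i)%:R))).
  rewrite rmorphB rmorph0 /= !mevalXU eqxx -[j == i]val_eqE gtn_eqF //.
pose w := (fr ('X_i - 'X_j))^-1.
pose spec := mmap (fr \o @mpolyC n rat) (spec_point (fr \o a) (fr 'X_i) (fr 'X_j) w).
have spec_fgen0 u l : spec u = fr (r l) -> spec (fgen u) = 0.
  move=> eu; rewrite /spec spec_fgen -/spec eu.
  have -> : 'X^n + \sum_(i < n) (fr \o a) i *: 'X^i =
            map_poly fr (\prod_(l < n) ('X - (r l)%:P)).
    have := congr1 (map_poly (mmap (@mpolyC n rat) r)) (prod_XsubC_vieta n rat).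
    rewrite rmorph_prod rmorphD rmorph_sum /= map_polyXn.
    under eq_bigr do rewrite rmorphB /= map_polyX map_polyC /= mmapX mmap1U.
    move=> ->; rewrite rmorphD rmorph_sum /= map_polyXn; congr (_ + _).
    by apply: eq_bigr => m _; rewrite !map_polyZ /= !map_polyXn.
  rewrite horner_map (bigD1 l) //= hornerM hornerXsubC subrr mul0r; exact: rmorph0.
have ri : r i = 'X_i by rewrite /r /midsubst /= eq_sym (negbTE ki).
have rj : r j = 'X_j by rewrite /r /midsubst /= (negbTE jk).
have : spec (embed_a p) = 0.
  rewrite ec /spec rmorph_sum big1 // => m _; rewrite rmorphM.
  suff e0 : spec (midpoint_gens n)`_m = 0 by rewrite [X in _ * X]e0 mulr0.
  case: m => -[|[|[|[|m]]]] //= _.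
  - by apply: (spec_fgen0 _ i); rewrite ri; apply: spec_var_x.
  - by apply: (spec_fgen0 _ j); rewrite rj; apply: spec_var_y.
  - apply: (spec_fgen0 _ k); rewrite /spec rmorphM rmorphD /= spec_var_x spec_var_y.
    by rewrite mmapC /= -rmorphD -rmorphM /r /midsubst /= eqxx.
  - rewrite /spec rmorphB rmorphM rmorphB /= spec_var_x spec_var_y spec_var_w rmorph1.
    by rewrite -rmorphB /w mulVf ?subrr // tofrac_eq0.
rewrite /spec spec_embed_a.
have -> : mmap (fr \o @mpolyC n rat) (fr \o a) p = fr (mmap (@mpolyC n rat) a p).
  by rewrite /fr rmorph_mmap.
move/eqP; rewrite tofrac_eq0 => /eqP e0; rewrite rmorph_mmap -[RHS]e0.
by apply: eq_mmap => [q|l] //=; rewrite mmapC.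
Qed.

Theorem proposition6 (n : nat) (hn : (3 <= n)%N) :
  (exists D : {mpoly rat[n]}, is_D2 D) /\
  forall D : {mpoly rat[n]}, is_D2 D ->
  forall p : {mpoly rat[n]},
    in_ideal [:: D] p <->
    in_ideal [:: fgen (var_x n); fgen (var_y n);
                 fgen (((2%:R : rat)^-1)%:MP * (var_x n + var_y n));
                 var_w n * (var_x n - var_y n) - 1] (embed_a p).
Proof.
split; first exact: (mmap_vieta_surj (D2_roots_sym n)).
move=> D hD p; split=> [/in_ideal1P[c ->]|hp].
  rewrite [embed_a _](rmorphM (mmap (@mpolyC (n + 3) rat) (@var_a n))).
  by apply: in_idealMl; apply: embed_D2_in_ideal.
have [q eq] := D2_roots_dvd (fun t ht => subst_vieta_eq0 ht hp).
(* A quotient of symmetric polynomials by the nonzero D_2(r) is symmetric, so it comes from some [Q]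
   in the coefficients, and injectivity of the Vieta map transfers the factorization. *)
have symq : q \is symmetric.
  apply: (msymMK (D2_roots_neq0 n) (D2_roots_sym n)).
  by rewrite -eq; apply: mmap_vieta_sym.
have [Q eQ] := mmap_vieta_surj symq.
apply/in_ideal1P; exists Q; apply/eqP; rewrite -subr_eq0; apply/eqP.
apply: mmap_vieta_inj; rewrite rmorphB rmorphM /= eQ.
by rewrite [X in X - _]eq -hD mulrC subrr.
Qed.
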